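(* Let $I\subset\mathbb{R}$ be an open interval and let $\alpha: I\to E^3$ be a smooth unit speed curve with Frenet vectors $T,N,B$, curvature $\kappa$ and torsion $\tau$, where $\kappa$ and $\tau$ are nowhere zero. Then $\alpha$ is a general helix if and only if the function $$s\mapsto \frac{\|B'(s)\|}{\|T'(s)\|}$$ is constant on $I$.
   Context: $E^3$ is Euclidean 3-space and primes denote derivatives with respect to the arclength parameter $s$. For a unit speed curve with $\kappa=\|T'\|\neq 0$, the Frenet vectors are $T=\alpha'$, $N=T'/\|T'\|$, $B=T\times N$, and they satisfy $T'=\kappa N$, $N'=-\kappa T+\tau B$, $B'=-\tau N$, where $\kappa$ is the curvature and $\tau$ the torsion. A curve is a general helix if its unit tangent $T$ makes a constant angle with some fixed direction (equivalently, $\tau/\kappa$ is constant). *)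

(* Defs.v *)
From mathcomp Require Import all_boot all_order all_algebra.
From mathcomp Require Import all_classical all_reals all_analysis.

Set Implicit Arguments.
Unset Strict Implicit.
Unset Printing Implicit Defensive.

Import Order.TTheory GRing.Theory Num.Theory.
Import numFieldNormedType.Exports.

Local Open Scope classical_set_scope.
Local Open Scope ring_scope.

(* The library norm `|u| on 'rV[R]_3 is the sup norm; it only provides the
   topology (hence the derivatives). Lengths and angles below are Euclidean. *)
Definition dotv (R : realType) (u v : 'rV[R]_3) : R := \sum_i u 0 i * v 0 i.

Definition enorm (R : realType) (u : 'rV[R]_3) : R := Num.sqrt (dotv u u).

Definition crossv (R : realType) (u v : 'rV[R]_3) : 'rV[R]_3 :=
  \row_(j < 3) [:: u 0 1 * v 0 2 - u 0 2 * v 0 1;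
                   u 0 2 * v 0 0 - u 0 0 * v 0 2;
                   u 0 0 * v 0 1 - u 0 1 * v 0 0]`_j.

(* Meaningful for nonzero u and v. *)
Definition angle (R : realType) (u v : 'rV[R]_3) : R :=
  acos (dotv u v / (enorm u * enorm v)).

(* A curve on I is a total function of which only the values on I matter: for
   open I, the derivatives at points of I do not depend on the values outside. *)
Definition smooth_on (R : realType) (I : set R) (f : R -> 'rV[R]_3) : Prop :=
  forall (n : nat) (s : R), I s -> derivable (derive1n n f) s 1.

Definition tangent (R : realType) (alpha : R -> 'rV[R]_3) : R -> 'rV[R]_3 :=
  derive1 alpha.

Definition unit_speed_on (R : realType) (I : set R) (alpha : R -> 'rV[R]_3)
    : Prop :=
  forall s : R, I s -> enorm (tangent alpha s) = 1.

Definition curvature (R : realType) (alpha : R -> 'rV[R]_3) (s : R) : R :=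
  enorm (derive1 (tangent alpha) s).

Definition principal_normal (R : realType) (alpha : R -> 'rV[R]_3) (s : R)
    : 'rV[R]_3 :=
  (curvature alpha s)^-1 *: derive1 (tangent alpha) s.

Definition binormal (R : realType) (alpha : R -> 'rV[R]_3) (s : R)
    : 'rV[R]_3 :=
  crossv (tangent alpha s) (principal_normal alpha s).

(* The coefficient tau in B' = - tau N, read off by pairing with the unit
   vector N. *)
Definition torsion (R : realType) (alpha : R -> 'rV[R]_3) (s : R) : R :=
  - dotv (derive1 (binormal alpha) s) (principal_normal alpha s).

Definition general_helix_on (R : realType) (I : set R)
    (alpha : R -> 'rV[R]_3) : Prop :=
  exists2 u : 'rV[R]_3, u != 0 &
    exists theta : R, forall s : R, I s -> angle (tangent alpha s) u = theta.

(* Main.v *)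
Require Import Defs.
From mathcomp Require Import all_boot all_order all_algebra.
From mathcomp Require Import all_classical all_reals all_analysis.
From mathcomp Require Import ring.

Set Implicit Arguments.
Unset Strict Implicit.
Unset Printing Implicit Defensive.

Import Order.TTheory GRing.Theory Num.Theory.
Import numFieldNormedType.Exports.

Local Open Scope classical_set_scope.
Local Open Scope ring_scope.

(** By the third Frenet formula B' = - tau N, the quotient of the norms of B'
    and T' is the absolute value of tau / kappa, so the theorem is Lancret's
    characterization of helices up to a sign.

    If T makes a constant angle with u, then p = T.u is constant, and
    differentiating twice gives N.u = 0 and tau (B.u) = kappa p. Expanding u in
    the Frenet frame, (B.u)^2 = u.u - p^2 is a nonzero constant, so the absolute
    value of tau / kappa is constant (fixed_tangent_component_ratio).

    Conversely, let the absolute value of tau / kappa be constant. This quotient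
    is differentiable and nowhere zero with a constant square, so its derivative
    vanishes and it is a constant m on the interval (torsion_curvature_const).
    Then m T + B has derivative (m kappa - tau) N = 0, so it is a fixed vector
    (helix_axis_const); its dot product with T is m and its norm is constant, so
    it makes a constant angle with T. It is nonzero as its component along B
    is 1. *)

(** * Euclidean geometry of three-space *)

Lemma dotvE (R : realType) (u v : 'rV[R]_3) :
  dotv u v = u 0 0 * v 0 0 + u 0 1 * v 0 1 + u 0 2 * v 0 2.
Proof.
rewrite /dotv !big_ord_recl big_ord0 addr0 addrA.
by congr (_ + u _ _ * v _ _ + u _ _ * v _ _); apply: val_inj.
Qed.

Lemma crossvE (R : realType) (u v : 'rV[R]_3) :
  (crossv u v 0 0 = u 0 1 * v 0 2 - u 0 2 * v 0 1) *
  (crossv u v 0 1 = u 0 2 * v 0 0 - u 0 0 * v 0 2) *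
  (crossv u v 0 2 = u 0 0 * v 0 1 - u 0 1 * v 0 0).
Proof. by rewrite !mxE. Qed.

Lemma ord3_ind (P : 'I_3 -> Prop) : P 0 -> P 1 -> P 2 -> forall j, P j.
Proof.
move=> P0 P1 P2 [[|[|[|//]]] j3]; [move: P0|move: P1|move: P2];
  by congr P; apply: val_inj.
Qed.

Lemma dotvC (R : realType) (u v : 'rV[R]_3) : dotv u v = dotv v u.
Proof. by rewrite !dotvE; ring. Qed.

Lemma dotvDl (R : realType) (u v w : 'rV[R]_3) :
  dotv (u + v) w = dotv u w + dotv v w.
Proof. by rewrite !dotvE !mxE; ring. Qed.

Lemma dotvZl (R : realType) (a : R) (u v : 'rV[R]_3) :
  dotv (a *: u) v = a * dotv u v.
Proof. by rewrite !dotvE !mxE; ring. Qed.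

Lemma dotv0l (R : realType) (u : 'rV[R]_3) : dotv 0 u = 0.
Proof. by rewrite -(scale0r 0) dotvZl mul0r. Qed.

Lemma dotv_ge0 (R : realType) (u : 'rV[R]_3) : 0 <= dotv u u.
Proof. by apply: sumr_ge0 => i _; rewrite -expr2 sqr_ge0. Qed.

Lemma dotv_eq0 (R : realType) (u : 'rV[R]_3) : (dotv u u == 0) = (u == 0).
Proof.
apply/idP/eqP => [|->]; last by rewrite dotvE !mxE !mul0r !addr0.
rewrite psumr_eq0 => [/allP u0|i _]; last by rewrite -expr2 sqr_ge0.
apply/rowP => i; rewrite mxE; apply/eqP.
by have := u0 i (mem_index_enum i); rewrite /= -expr2 sqrf_eq0.
Qed.

Lemma crossv_orthol (R : realType) (u v : 'rV[R]_3) : dotv (crossv u v) u = 0.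
Proof. by rewrite !dotvE !crossvE; ring. Qed.

Lemma crossv_orthor (R : realType) (u v : 'rV[R]_3) : dotv (crossv u v) v = 0.
Proof. by rewrite !dotvE !crossvE; ring. Qed.

(** Polarized Gram identity: the product of the determinants of (x, t, n) and of
    (y, t, n) is the determinant of the matrix of dot products of the first
    triple with the second. For orthonormal t and n it expands the dot product
    of x and y in the frame t, n, t x n, which spares any discussion of
    bases. *)
Lemma crossv_gram (R : realType) (t n x y : 'rV[R]_3) :
  dotv x (crossv t n) * dotv y (crossv t n) =
    dotv x y * (dotv t t * dotv n n - dotv t n ^+ 2)
    - dotv x t * (dotv y t * dotv n n - dotv y n * dotv t n)
    - dotv x n * (dotv y n * dotv t t - dotv y t * dotv t n).
Proof. by rewrite !dotvE !crossvE; ring. Qed.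

(** Lagrange's identity; as the left-hand side is nonnegative, it contains the
    Cauchy-Schwarz inequality. *)
Lemma sqr_crossv (R : realType) (u v : 'rV[R]_3) :
  dotv (crossv u v) (crossv u v) = dotv u u * dotv v v - dotv u v ^+ 2.
Proof. by rewrite !dotvE !crossvE; ring. Qed.

(** The Gram identity applied to x - y writes its squared length as the sum of
    the squares of its three components, all zero. The Frenet formulas are
    checked component by component in this way. *)
Lemma orthonormal_frame_inj (R : realType) (t n x y : 'rV[R]_3) :
  dotv t t = 1 -> dotv n n = 1 -> dotv t n = 0 ->
  dotv x t = dotv y t -> dotv x n = dotv y n ->
  dotv x (crossv t n) = dotv y (crossv t n) -> x = y.
Proof.
move=> tt nn tn xyt xyn xyb.
have dot0 w : dotv x w = dotv y w -> dotv (x - y) w = 0.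
  by move=> xyw; rewrite dotvDl -scaleN1r dotvZl xyw mulN1r subrr.
apply/eqP; rewrite -subr_eq0 -dotv_eq0.
have := crossv_gram t n (x - y) (x - y).
rewrite (dot0 t)// (dot0 n)// (dot0 (crossv t n))// tt nn tn expr0n /=.
by rewrite !(mul0r, mulr1, subr0) => <-.
Qed.

Lemma sqr_enorm (R : realType) (u : 'rV[R]_3) : enorm u ^+ 2 = dotv u u.
Proof. by rewrite sqr_sqrtr ?dotv_ge0. Qed.

Lemma cauchy_schwarz_dotv (R : realType) (u v : 'rV[R]_3) :
  `|dotv u v| <= enorm u * enorm v.
Proof.
rewrite -sqrtrM ?dotv_ge0// -sqrtr_sqr ler_wsqrtr//.
by rewrite -subr_ge0 -sqr_crossv dotv_ge0.
Qed.

Lemma enorm_gt0 (R : realType) (u : 'rV[R]_3) : u != 0 -> 0 < enorm u.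
Proof. by move=> u0; rewrite sqrtr_gt0 lt_def dotv_ge0 dotv_eq0 u0. Qed.

(** By the Cauchy-Schwarz inequality the quotient lies in [-1, 1], where cos
    inverts acos. *)
Lemma cos_angle (R : realType) (u v : 'rV[R]_3) : u != 0 -> v != 0 ->
  cos (angle u v) * (enorm u * enorm v) = dotv u v.
Proof.
move=> u0 v0; have uv_gt0 := mulr_gt0 (enorm_gt0 u0) (enorm_gt0 v0).
rewrite acosK ?divfK ?gt_eqF// in_itv /= -ler_norml normrM normfV.
by rewrite (gtr0_norm uv_gt0) ler_pdivrMr// mul1r cauchy_schwarz_dotv.
Qed.

(** * Calculus of vector-valued functions *)

Lemma is_derive_row (R : realType) (f : R -> 'rV[R]_3) (s : R) (df : 'rV[R]_3) :
  is_derive s 1 f df <->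
  forall j, is_derive s 1 (fun t => f t 0 j) (df 0 j).
Proof.
split=> [[fs dfE] j|fs].
  have fj := (derivable_mxP f s 1).1 fs.
  by apply: DeriveDef; [exact: fj | rewrite -dfE derive_mx// mxE].
have fd : derivable f s 1.
  by apply/derivable_mxP => i j; rewrite (ord1 i); case: (fs j).
apply: DeriveDef => //; rewrite derive_mx//.
by apply/rowP => j; rewrite mxE derive_val.
Qed.

Lemma is_derive_dotv (R : realType) (f g : R -> 'rV[R]_3) (s : R)
    (df dg : 'rV[R]_3) :
  is_derive s 1 f df -> is_derive s 1 g dg ->
  is_derive s 1 (fun t => dotv (f t) (g t)) (dotv df (g s) + dotv (f s) dg).
Proof.
move=> /is_derive_row Hf /is_derive_row Hg.
under eq_fun do rewrite dotvE.
by apply: is_derive_eq; rewrite !dotvE /GRing.scale/=; ring.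
Qed.

Lemma is_derive_crossv (R : realType) (f g : R -> 'rV[R]_3) (s : R)
    (df dg : 'rV[R]_3) :
  is_derive s 1 f df -> is_derive s 1 g dg ->
  is_derive s 1 (fun t => crossv (f t) (g t))
    (crossv df (g s) + crossv (f s) dg).
Proof.
move=> /is_derive_row Hf /is_derive_row Hg.
apply/is_derive_row => j.
elim/ord3_ind: j; under eq_fun do rewrite crossvE;
  by apply: is_derive_eq; rewrite !mxE /= /GRing.scale/=; ring.
Qed.

Lemma is_derive_scale (R : realType) (h : R -> R) (f : R -> 'rV[R]_3) (s : R)
    (dh : R) (df : 'rV[R]_3) :
  is_derive s 1 h dh -> is_derive s 1 f df ->
  is_derive s 1 (fun t => h t *: f t) (dh *: f s + h s *: df).
Proof.
move=> Hh /is_derive_row Hf; apply/is_derive_row => j.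
under eq_fun do rewrite mxE.
by apply: is_derive_eq; rewrite !mxE /GRing.scale/=; ring.
Qed.

(** The derivative at a point of an open set depends only on the values on that
    set. This is how an identity between the Frenet vectors, valid only on I, is
    differentiated. *)
Lemma is_derive_const_on (R : realType) (V : normedModType R) (I : set R)
    (f : R -> V) (c df : V) (s : R) :
  open I -> I s -> (forall t, I t -> f t = c) -> is_derive s 1 f df -> df = 0.
Proof.
move=> openI Is fc fs.
have near_fc : \near s, cst c s = f s.
  have /filterS : nbhs s I by exact: open_nbhs_nbhs.
  by apply => t It; rewrite fc.
have f0 : is_derive s 1 f 0 by apply: near_eq_is_derive near_fc _.
by rewrite -(@derive_val _ _ _ _ _ _ _ fs) derive_val.
Qed.

Lemma derive0_const_on (R : realType) (I : set R) (f : R -> R) (x y : R) :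
  is_interval I -> (forall t, I t -> is_derive t 1 f 0) ->
  I x -> I y -> f x = f y.
Proof.
move=> itvI f0; wlog xy : x y / x <= y => [wlog_le Ix Iy|Ix Iy].
  by have [xy|/ltW yx] := leP x y; [|symmetry]; apply: wlog_le.
have Ixy z : z \in `[x, y]%R -> I z by rewrite in_itv; apply: itvI.
have [||z _] := @MVT_segment R f (cst 0) x y xy.
- by move=> z zxy; apply/f0/Ixy/subset_itv_oo_cc.
- apply: derivable_within_continuous => z zxy.
  by case: (f0 z (Ixy _ zxy)).
- by rewrite mul0r => /subr0_eq.
Qed.

Lemma derive0_const_on_row (R : realType) (I : set R) (f : R -> 'rV[R]_3)
    (x y : R) :
  is_interval I -> (forall t, I t -> is_derive t 1 f 0) ->
  I x -> I y -> f x = f y.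
Proof.
move=> itvI f0 Ix Iy; apply/rowP => j.
apply: (@derive0_const_on R I (fun t => f t 0 j)) => // t It.
by move/is_derive_row: (f0 t It) => /(_ j); rewrite mxE.
Qed.

(** * The Frenet frame *)

Section FrenetFrame.
Context {R : realType} {I : set R} {alpha : R -> 'rV[R]_3}.
Hypothesis openI : open I.
Hypothesis alpha_smooth : smooth_on I alpha.
Hypothesis alpha_unit : unit_speed_on I alpha.
Hypothesis kappa_neq0 : forall s : R, I s -> curvature alpha s != 0.

Local Notation T := (tangent alpha).
Local Notation N := (principal_normal alpha).
Local Notation B := (binormal alpha).
Local Notation kappa := (curvature alpha).
Local Notation tau := (torsion alpha).

(** The first Frenet formula, which is the definition of N. *)
Lemma derive1_tangentE s : I s -> derive1 T s = kappa s *: N s.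
Proof. by move=> Is; rewrite scalerA divff ?scale1r ?kappa_neq0. Qed.

Lemma is_derive_tangent s : I s -> is_derive s 1 T (kappa s *: N s).
Proof.
move=> Is; rewrite -(derive1_tangentE Is) derive1E.
apply/derivableP; exact: (@alpha_smooth 1%N).
Qed.

Lemma is_derive_tangent_derive1 s :
  I s -> is_derive s 1 (derive1 T) (derive1n 3 alpha s).
Proof.
move=> Is; rewrite derive1nS derive1E.
apply/derivableP; exact: (@alpha_smooth 2%N).
Qed.

Lemma dotv_TT s : I s -> dotv (T s) (T s) = 1.
Proof. by move=> Is; rewrite -sqr_enorm alpha_unit// expr1n. Qed.

Lemma dotv_NN s : I s -> dotv (N s) (N s) = 1.
Proof.
move=> Is; rewrite dotvZl dotvC dotvZl -sqr_enorm -/(kappa s).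
by rewrite mulrA -expr2 -exprMn mulVf ?expr1n// kappa_neq0.
Qed.

Lemma dotv_TN s : I s -> dotv (T s) (N s) = 0.
Proof.
move=> Is; have Ts := is_derive_tangent Is.
have := is_derive_const_on openI Is dotv_TT (is_derive_dotv Ts Ts).
rewrite dotvZl [dotv (T s) _]dotvC dotvZl dotvC -mulr2n => /eqP.
by rewrite mulrn_eq0 /= mulf_eq0 (negPf (kappa_neq0 Is)) => /eqP.
Qed.

(** The square root is differentiable at kappa^2 = T'.T' because kappa does not
    vanish. *)
Lemma is_derive_curvature s : I s -> exists dk, is_derive s 1 kappa dk.
Proof.
move=> Is; have T's := is_derive_tangent_derive1 Is.
have TT_gt0 : 0 < dotv (derive1 T s) (derive1 T s).
  by rewrite lt_def dotv_ge0 -sqr_enorm sqrf_eq0 kappa_neq0.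
eexists; apply: is_derive1_comp (is_derive1_sqrt TT_gt0) _.
exact: is_derive_dotv.
Qed.

Lemma is_derive_normal_derive1 s : I s -> is_derive s 1 N (derive1 N s).
Proof.
move=> Is; have [dk ks] := is_derive_curvature Is.
have kVs := is_deriveV (kappa_neq0 Is) ks.
have [Ns _] := is_derive_scale kVs (is_derive_tangent_derive1 Is).
by rewrite derive1E; exact/derivableP.
Qed.

Lemma is_derive_binormal_derive1 s : I s -> is_derive s 1 B (derive1 B s).
Proof.
move=> Is.
have [Bs _] :=
  is_derive_crossv (is_derive_tangent Is) (is_derive_normal_derive1 Is).
by rewrite derive1E; exact/derivableP.
Qed.

Lemma dotv_BB s : I s -> dotv (B s) (B s) = 1.
Proof.
move=> Is; have tt := dotv_TT Is; have nn := dotv_NN Is.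
have := sqr_crossv (T s) (N s).
by rewrite tt nn (dotv_TN Is) expr0n /= mulr1 subr0.
Qed.

(** The components of B' along T and B vanish: B.T = 0 gives
    B'.T = - B.T' = - kappa B.N = 0, and B.B = 1 gives B'.B = 0. The component
    along N is - tau by definition. *)
Lemma derive1_binormalE s : I s -> derive1 B s = - tau s *: N s.
Proof.
move=> Is; have Ts := is_derive_tangent Is.
have Bs := is_derive_binormal_derive1 Is.
have BT t : I t -> dotv (B t) (T t) = 0 by move=> _; exact: crossv_orthol.
have := is_derive_const_on openI Is BT (is_derive_dotv Bs Ts).
rewrite dotvC [dotv (B s) _]dotvC dotvZl [dotv (N s) _]dotvC crossv_orthor.
rewrite mulr0 addr0 => TB'.
have := is_derive_const_on openI Is dotv_BB (is_derive_dotv Bs Bs).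
rewrite [dotv (B s) _]dotvC -mulr2n => /eqP; rewrite mulrn_eq0 /= => /eqP BB'.
apply: (orthonormal_frame_inj (dotv_TT Is) (dotv_NN Is) (dotv_TN Is)).
- by rewrite dotvC TB' dotvZl dotvC dotv_TN// mulr0.
- by rewrite dotvZl dotv_NN// mulr1 opprK.
- by rewrite -/(B s) BB' dotvZl dotvC crossv_orthor mulr0.
Qed.

Lemma is_derive_binormal s : I s -> is_derive s 1 B (- tau s *: N s).
Proof.
move=> Is; rewrite -(derive1_binormalE Is).
exact: is_derive_binormal_derive1.
Qed.

(** The components of N' come from differentiating T.N = 0, N.N = 1 and
    B.N = 0, with T' and B' already known. *)
Lemma is_derive_normal s :
  I s -> is_derive s 1 N (- kappa s *: T s + tau s *: B s).
Proof.
move=> Is; have Ts := is_derive_tangent Is.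
have Ns := is_derive_normal_derive1 Is; have Bs := is_derive_binormal Is.
suff <- : derive1 N s = - kappa s *: T s + tau s *: B s by [].
have NN' := is_derive_const_on openI Is dotv_NN (is_derive_dotv Ns Ns).
have TN' := is_derive_const_on openI Is dotv_TN (is_derive_dotv Ts Ns).
have BN t : I t -> dotv (B t) (N t) = 0 by move=> _; exact: crossv_orthor.
have BN' := is_derive_const_on openI Is BN (is_derive_dotv Bs Ns).
have tt := dotv_TT Is; have nn := dotv_NN Is; have tn := dotv_TN Is.
have bb := dotv_BB Is.
have bt : dotv (B s) (T s) = 0 by exact: crossv_orthol.
apply: (orthonormal_frame_inj tt nn tn); rewrite -?/(B s) dotvDl !dotvZl.
- rewrite tt bt mulr1 mulr0 addr0; apply/eqP; rewrite -addr_eq0; apply/eqP.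
  by rewrite -TN' dotvZl nn mulr1 addrC [dotv (T s) _]dotvC.
- rewrite tn BN// !mulr0 addr0; move/eqP: NN'.
  by rewrite [dotv (N s) _]dotvC -mulr2n mulrn_eq0 /= => /eqP.
- rewrite [dotv (T s) _]dotvC bt bb mulr0 mulr1 add0r.
  apply/eqP; rewrite -subr_eq0; apply/eqP.
  by rewrite -BN' dotvZl nn mulr1 addrC [dotv (B s) _]dotvC.
Qed.

(** Differentiate T' = kappa N and take the component along B. Since tau is
    defined through B', hence through N', this formula is what shows that tau is
    itself differentiable. *)
Lemma curvatureM_torsion s : I s ->
  kappa s * tau s = dotv (derive1n 3 alpha s) (B s).
Proof.
move=> Is; have [dk ks] := is_derive_curvature Is.
have kN := is_derive_scale ks (is_derive_normal Is).
have kNT' : \near s, kappa s *: N s = derive1 T s.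
  have /filterS : nbhs s I by exact: open_nbhs_nbhs.
  by apply => t It; rewrite derive1_tangentE.
have T's := near_eq_is_derive kNT' kN.
have T''s := is_derive_tangent_derive1 Is.
rewrite -(@derive_val _ _ _ _ _ _ _ T''s) (@derive_val _ _ _ _ _ _ _ T's).
rewrite dotvDl (dotvZl dk) (dotvZl (kappa s)) dotvDl.
rewrite (dotvZl (- kappa s)) (dotvZl (tau s)) dotv_BB//.
rewrite [dotv (N s) _]dotvC [dotv (T s) _]dotvC crossv_orthor crossv_orthol.
by rewrite !mulr0 !add0r mulr1.
Qed.

Lemma curvature_gt0 s : I s -> 0 < kappa s.
Proof. by move=> Is; rewrite lt_def kappa_neq0 ?sqrtr_ge0. Qed.

Lemma enorm_ratioE s : I s ->
  enorm (derive1 B s) / enorm (derive1 T s) = `|tau s / kappa s|.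
Proof.
move=> Is; rewrite derive1_binormalE// -/(kappa s) normrM normfV.
rewrite (gtr0_norm (curvature_gt0 Is)); congr (_ / _).
by rewrite /enorm dotvZl dotvC dotvZl dotv_NN// mulr1 -expr2 sqrtr_sqr normrN.
Qed.

(** The quotient tau / kappa = (T''.B) / (T'.T') is a quotient of
    differentiable functions with nonzero denominator. *)
Lemma derivable_torsion_curvature s : I s ->
  exists d, is_derive s 1 (fun t => tau t / kappa t) d.
Proof.
move=> Is.
have T3 : is_derive s 1 (derive1n 3 alpha) (derive1n 4 alpha s).
  rewrite [derive1n 4 _]derive1nS derive1E.
  by apply/derivableP; exact: (@alpha_smooth 3%N).
have T3B := is_derive_dotv T3 (is_derive_binormal Is).
have T's := is_derive_tangent_derive1 Is.
have TT := is_derive_dotv T's T's.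
have TT0 : dotv (derive1 T s) (derive1 T s) != 0.
  by rewrite -sqr_enorm sqrf_eq0 kappa_neq0.
have TTV := is_deriveV TT0 TT.
eexists; apply: near_eq_is_derive (is_deriveM T3B TTV).
have /filterS : nbhs s I by exact: open_nbhs_nbhs.
apply => t It /=; rewrite -[RHS]mulr1 -(divff (kappa_neq0 It)) mulrACA.
by rewrite [tau t * _]mulrC curvatureM_torsion// -invfM -expr2 sqr_enorm.
Qed.

(** * Curves whose tangent has a constant component *)

(** If T.u is a constant p, then differentiating gives N.u = 0, and
    differentiating once more gives tau (B.u) = kappa p. As u has no component
    along N, its component along B satisfies (B.u)^2 = u.u - p^2, so its
    absolute value is constant too. It is nonzero: otherwise p, hence u, would
    vanish. *)
Lemma fixed_tangent_component_ratio (u : 'rV[R]_3) (p : R) : u != 0 ->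
  (forall s, I s -> dotv (T s) u = p) ->
  forall s, I s -> `|tau s / kappa s| = `|p| / Num.sqrt (dotv u u - p ^+ 2).
Proof.
move=> u0 Tu.
have Nu s : I s -> dotv (N s) u = 0.
  move=> Is; have Ts := is_derive_tangent Is.
  have := is_derive_const_on openI Is Tu
            (is_derive_dotv Ts (is_derive_cst u s 1)).
  rewrite (dotvZl (kappa s)) [dotv (T s) _]dotvC (dotv0l (T s)) addr0 => /eqP.
  by rewrite mulf_eq0 (negPf (kappa_neq0 Is)) => /eqP.
move=> s Is.
have kp : tau s * dotv (B s) u = kappa s * p.
  have Ns := is_derive_normal Is.
  have := is_derive_const_on openI Is Nu
            (is_derive_dotv Ns (is_derive_cst u s 1)).
  rewrite [dotv (N s) 0]dotvC dotv0l addr0 dotvDl.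
  rewrite (dotvZl (- kappa s)) (dotvZl (tau s)).
  by rewrite (Tu _ Is) mulNr addrC => /subr0_eq.
have Bu2 : dotv (B s) u ^+ 2 = dotv u u - p ^+ 2.
  have := crossv_gram (T s) (N s) u u; rewrite -/(B s).
  rewrite [dotv u (B s)]dotvC [dotv u (T s)]dotvC [dotv u (N s)]dotvC.
  rewrite dotv_TT// dotv_NN// dotv_TN// (Nu _ Is) (Tu _ Is).
  by rewrite expr0n /= !(mulr0, mul0r, mulr1, subr0) -!expr2.
have Bu0 : dotv (B s) u != 0.
  apply/eqP => Bu0; move/esym/eqP: kp; rewrite Bu0 mulr0 mulf_eq0.
  rewrite (negPf (kappa_neq0 Is)) /= => /eqP p0; move: Bu2.
  by rewrite Bu0 p0 expr0n /= subr0 => /esym/eqP; rewrite dotv_eq0 (negPf u0).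
have -> : tau s / kappa s = p / dotv (B s) u.
  by apply/eqP; rewrite eqr_div// ?kappa_neq0// kp mulrC.
by rewrite -Bu2 sqrtr_sqr normrM normfV.
Qed.

(** The square of f = tau / kappa is constant, so f f' = 0, and f' = 0 since f
    does not vanish: the sign of f cannot jump. *)
Lemma torsion_curvature_const (c : R) : is_interval I ->
  (forall s, I s -> tau s != 0) ->
  (forall s, I s -> `|tau s / kappa s| = c) ->
  forall s t, I s -> I t -> tau s / kappa s = tau t / kappa t.
Proof.
move=> intervalI tau_neq0 ratio s t.
apply: (derive0_const_on (f := fun t => tau t / kappa t)) => // r Ir.
have [d fr] := derivable_torsion_curvature Ir.
have f2c x : I x -> (tau x / kappa x) * (tau x / kappa x) = c ^+ 2.
  by move=> Ix; rewrite -expr2 -(ratio _ Ix) real_normK// num_real.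
have := is_derive_const_on openI Ir f2c (is_deriveM fr fr).
move/eqP; rewrite -mulr2n mulrn_eq0 /= scaler_eq0 mulf_eq0 invr_eq0.
by rewrite (negPf (tau_neq0 _ Ir)) (negPf (kappa_neq0 Ir)) /= => /eqP <-.
Qed.

(** By the Frenet formulas the derivative of m T + B is
    (m kappa - tau) N = 0. *)
Lemma helix_axis_const (m : R) : is_interval I ->
  (forall s, I s -> tau s / kappa s = m) ->
  forall s t, I s -> I t -> m *: T s + B s = m *: T t + B t.
Proof.
move=> intervalI taum s t.
apply: (derive0_const_on_row (f := fun t => m *: T t + B t)) => // r Ir.
have mT := is_derive_scale (is_derive_cst m r 1) (is_derive_tangent Ir).
apply: is_derive_eq (is_deriveD mT (is_derive_binormal Ir)) _.
rewrite scale0r add0r scalerA -scalerDl -(taum _ Ir) divfK ?kappa_neq0//.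
by rewrite subrr scale0r.
Qed.

End FrenetFrame.

Theorem theorem8 (R : realType) (I : set R) (alpha : R -> 'rV[R]_3)
    (openI : open I) (intervalI : is_interval I)
    (alpha_smooth : smooth_on I alpha)
    (alpha_unit : unit_speed_on I alpha)
    (kappa_neq0 : forall s : R, I s -> curvature alpha s != 0)
    (tau_neq0 : forall s : R, I s -> torsion alpha s != 0) :
  general_helix_on I alpha <->
  exists c : R, forall s : R, I s ->
    enorm (derive1 (binormal alpha) s) / enorm (derive1 (tangent alpha) s) = c.
Proof.
have ratioE := enorm_ratioE openI alpha_smooth alpha_unit kappa_neq0.
split=> [[u u0 [theta angleE]]|[c ratio_c]].
  exists (`|cos theta * enorm u|
          / Num.sqrt (dotv u u - (cos theta * enorm u) ^+ 2)) => s Is.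
  rewrite ratioE//.
  apply: (fixed_tangent_component_ratio openI alpha_smooth alpha_unit) => //.
  move=> t It.
  have T0 : tangent alpha t != 0.
    by rewrite -dotv_eq0 (dotv_TT alpha_unit It) oner_neq0.
  by rewrite -(cos_angle T0 u0) angleE// alpha_unit// mul1r.
have [[s0 Is0]|I0] := pselect (exists s, I s); last first.
  (* On an empty I every direction is an axis. *)
  exists (const_mx 1).
    by apply/eqP => /rowP/(_ 0); rewrite !mxE => /eqP; rewrite oner_eq0.
  by exists 0 => s Is; case: I0; exists s.
have ratio_abs s (Is : I s) : `|torsion alpha s / curvature alpha s| = c.
  by rewrite -ratioE// ratio_c.
pose m := torsion alpha s0 / curvature alpha s0.
have ratio_m s (Is : I s) : torsion alpha s / curvature alpha s = m.
  exact: (torsion_curvature_const openI alpha_smooth alpha_unit kappa_neq0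
            intervalI tau_neq0 ratio_abs).
pose axis s := m *: tangent alpha s + binormal alpha s.
have axisE s (Is : I s) : axis s0 = axis s.
  exact: (helix_axis_const openI alpha_smooth alpha_unit kappa_neq0
            intervalI ratio_m).
exists (axis s0).
  apply/eqP => axis0; have := dotv0l (binormal alpha s0).
  rewrite -axis0 dotvDl (dotvZl m) [dotv (tangent _ _) _]dotvC crossv_orthol.
  rewrite (dotv_BB openI alpha_smooth alpha_unit kappa_neq0 Is0) mulr0 add0r.
  by move/eqP; rewrite oner_eq0.
exists (acos (m / enorm (axis s0))) => s Is.
rewrite /angle alpha_unit// mul1r; congr (acos (_ / _)).
rewrite (axisE s Is) dotvC dotvDl (dotvZl m) crossv_orthol addr0.
by rewrite (dotv_TT alpha_unit Is) mulr1.
Qed.
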